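(* The set of all binary trees avoiding, as subtrees, each of the following eleven trees is a Poincaré-Birkhoff-Witt basis of the operad $\mathsf{CAs}^{(3)}$. The eleven trees are the left-hand members of the rewrite rule $\to$ consisting of these pairs (each parenthesized expression, with $\star$ written as juxtaposition, denotes the binary tree that is its syntax tree): 1. $((x_1x_2)x_3)x_4 \to x_1(x_2(x_3x_4))$; 2. $(x_1(x_2(x_3x_4)))x_5 \to (x_1x_2)(x_3(x_4x_5))$; 3. $x_1((x_2(x_3x_4))(x_5x_6)) \to x_1(x_2(x_3(x_4(x_5x_6))))$; 4. $x_1(x_2((x_3(x_4x_5))x_6)) \to x_1(x_2(x_3(x_4(x_5x_6))))$; 5. $(x_1((x_2x_3)x_4))(x_5(x_6x_7)) \to (x_1x_2)(x_3(x_4(x_5(x_6x_7))))$; 6. $x_1((x_2x_3)(x_4(x_5(x_6x_7)))) \to x_1(x_2(x_3((x_4x_5)(x_6x_7))))$; 7. $x_1(x_2((x_3x_4)(x_5(x_6x_7)))) \to x_1(x_2(x_3(x_4((x_5x_6)x_7))))$; 8. $x_1(x_2(x_3((x_4x_5)((x_6x_7)x_8)))) \to x_1(x_2(x_3(x_4(x_5(x_6(x_7x_8))))))$; 9. $(x_1(x_2x_3))(x_4(x_5(x_6(x_7x_8)))) \to (x_1x_2)(x_3(x_4(x_5((x_6x_7)x_8))))$; 10. $x_1(x_2(x_3(x_4((x_5x_6)(x_7x_8))))) \to x_1(x_2(x_3(x_4(x_5((x_6x_7)x_8)))))$; 11. $(x_1x_2)(x_3(x_4((x_5x_6)(x_7x_8))))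 \to (x_1x_2)(x_3(x_4(x_5((x_6x_7)x_8))))$. That is, $\to$ is a convergent orientation of $\equiv^{(3)}$ and the trees avoiding its left-hand members are exactly the normal forms of the induced rewrite relation; in particular each $\equiv^{(3)}$-equivalence class contains exactly one of them.
   Context: Operads are nonsymmetric and set-theoretic, with partial compositions $\circ_i$ and complete composition $\circ$. $\mathsf{Mag}$ is the free operad on one binary generator $\star$; its elements are the (planar, complete) binary trees, the arity $|\mathfrak{t}|$ of a tree being its number of leaves, and $\mathfrak{t}\circ_i\mathfrak{s}$ being obtained by grafting the root of $\mathfrak{s}$ onto the $i$-th leaf of $\mathfrak{t}$. The complete composition $\mathfrak{s}\circ[\mathfrak{r}_1,\dots,\mathfrak{r}_n]$ ($n=|\mathfrak{s}|$) grafts $\mathfrak{r}_i$ onto the $i$-th leaf of $\mathfrak{s}$ for all $i$. An operad congruence on $\mathsf{Mag}$ is an arity-preserving equivalence relation compatible with all partial compositions. $\mathsf{CAs}^{(3)} = \mathsf{Mag}/_{\equiv^{(3)}}$, where $\equiv^{(3)}$ is the smallest operad congruence of $\mathsf{Mag}$ identifying the left comb tree and the right comb tree with $3$ internal nodes, i.e. $((x_1x_2)x_3)x_4 \equiv^{(3)} x_1(x_2(x_3x_4))$. Given a rewrite rule $\to$ on $\mathsf{Mag}$ (a set of pairs $\mathfrak{s}\to\mathfrak{s}'$ of trees of the same arity), the induced rewrite relation $\Rightarrow$ is defined by $\mathfrak{t}\circ_i(\mathfrak{s}\circ[\mathfrak{r}_1,\dots,\mathfrak{r}_n]) \Rightarrow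 \mathfrak{t}\circ_i(\mathfrak{s}'\circ[\mathfrak{r}_1,\dots,\mathfrak{r}_n])$ whenever $\mathfrak{s}\to\mathfrak{s}'$, with $n=|\mathfrak{s}|$ and $\mathfrak{t},\mathfrak{r}_1,\dots,\mathfrak{r}_n$ any binary trees (possibly reduced to a leaf). A tree $\mathfrak{u}$ avoids $\mathfrak{s}$ as a subtree if $\mathfrak{u}$ is not of the form $\mathfrak{t}\circ_i(\mathfrak{s}\circ[\mathfrak{r}_1,\dots,\mathfrak{r}_n])$ for any such trees. The rule $\to$ is an orientation of a congruence $\equiv$ if the reflexive, symmetric and transitive closure of $\Rightarrow$ is $\equiv$; it is a convergent orientation if moreover $\Rightarrow$ is terminating and confluent. When $\to$ is a convergent orientation of $\equiv$, the set of all normal forms of $\Rightarrow$ (trees that cannot be rewritten) is called a Poincaré-Birkhoff-Witt basis of the operad $\mathsf{Mag}/_{\equiv}$. *)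

(* Defs.v *)
From Stdlib Require Export Relations.
From mathcomp Require Export all_boot.

Set Implicit Arguments.
Unset Strict Implicit.
Unset Printing Implicit Defensive.

(* The elements of the free nonsymmetric operad [Mag] on one binary generator;
   [Leaf] is the unit of the operad. *)
Inductive tree : Type := Leaf | Node of tree & tree.

Declare Scope tree_scope.
Delimit Scope tree_scope with tree.
Bind Scope tree_scope with tree.
Notation "s * t" := (Node s t) : tree_scope.

Fixpoint arity (t : tree) : nat :=
  if t is Node l r then arity l + arity r else 1.

(* [t o_i s]. Leaves are numbered from 1, from left to right; the value is [t]
   when [i] is not in [1 .. arity t]. *)
Fixpoint pcomp (t : tree) (i : nat) (s : tree) : tree :=
  match t with
  | Leaf => if i == 1 then s else Leaf
  | Node l r => if i <= arity l then Node (pcomp l i s) r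
                else Node l (pcomp r (i - arity l) s)
  end.

(* [s o [r_1, ..., r_n]], meaningful when [size rs = arity s]. *)
Fixpoint ccomp (s : tree) (rs : seq tree) : tree :=
  match s with
  | Leaf => head Leaf rs
  | Node l r => Node (ccomp l (take (arity l) rs)) (ccomp r (drop (arity l) rs))
  end.

Record operad_congruence (E : relation tree) : Prop := OperadCongruence {
  cong_equiv : equivalence tree E;
  cong_arity : forall t u, E t u -> arity t = arity u;
  cong_pcomp : forall t t' s s' i, 1 <= i <= arity t ->
    E t t' -> E s s' -> E (pcomp t i s) (pcomp t' i s')
}.

Section RewriteSystems.

Variable rule : relation tree.

Definition rewrite (t u : tree) : Prop :=
  exists (c : tree) (i : nat) (s s' : tree) (rs : seq tree),
    [/\ rule s s', 1 <= i <= arity c, size rs = arity s,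
        t = pcomp c i (ccomp s rs) & u = pcomp c i (ccomp s' rs)].

Definition normal_form (t : tree) : Prop := ~ exists u, rewrite t u.

Definition terminating : Prop :=
  ~ exists f : nat -> tree, forall n, rewrite (f n) (f n.+1).

Definition confluent : Prop :=
  forall t u v,
    clos_refl_trans tree rewrite t u -> clos_refl_trans tree rewrite t v ->
    exists w, clos_refl_trans tree rewrite u w /\
              clos_refl_trans tree rewrite v w.

Definition orientation (E : relation tree) : Prop :=
  (forall s s', rule s s' -> arity s = arity s') /\
  (forall t u, clos_refl_sym_trans tree rewrite t u <-> E t u).

Definition convergent_orientation (E : relation tree) : Prop :=
  [/\ orientation E, terminating & confluent].

End RewriteSystems.

Definition avoids (u s : tree) : Prop :=
  ~ exists (c : tree) (i : nat) (rs : seq tree),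
      [/\ 1 <= i <= arity c, size rs = arity s & u = pcomp c i (ccomp s rs)].

(* [B] is a Poincare-Birkhoff-Witt basis of the quotient operad [Mag / E]. *)
Definition PBW_basis (E : relation tree) (B : tree -> Prop) : Prop :=
  operad_congruence E /\
  exists rule : relation tree,
    convergent_orientation rule E /\ (forall u, B u <-> normal_form rule u).

Local Notation x := Leaf.
Local Open Scope tree_scope.

(* The smallest operad congruence identifying the two combs, as the
   intersection of all of them; [CAs3] is the quotient of [Mag] by it. *)
Definition CAs3_cong (t u : tree) : Prop :=
  forall E : relation tree, operad_congruence E ->
    E (((x * x) * x) * x) (x * (x * (x * x))) -> E t u.

Inductive CAs3_rule : tree -> tree -> Prop :=
| CAs3_rule1 : CAs3_rule
    (((x * x) * x) * x)
    (x * (x * (x * x)))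
| CAs3_rule2 : CAs3_rule
    ((x * (x * (x * x))) * x)
    ((x * x) * (x * (x * x)))
| CAs3_rule3 : CAs3_rule
    (x * ((x * (x * x)) * (x * x)))
    (x * (x * (x * (x * (x * x)))))
| CAs3_rule4 : CAs3_rule
    (x * (x * ((x * (x * x)) * x)))
    (x * (x * (x * (x * (x * x)))))
| CAs3_rule5 : CAs3_rule
    ((x * ((x * x) * x)) * (x * (x * x)))
    ((x * x) * (x * (x * (x * (x * x)))))
| CAs3_rule6 : CAs3_rule
    (x * ((x * x) * (x * (x * (x * x)))))
    (x * (x * (x * ((x * x) * (x * x)))))
| CAs3_rule7 : CAs3_rule
    (x * (x * ((x * x) * (x * (x * x)))))
    (x * (x * (x * (x * ((x * x) * x)))))
| CAs3_rule8 : CAs3_rule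
    (x * (x * (x * ((x * x) * ((x * x) * x)))))
    (x * (x * (x * (x * (x * (x * (x * x)))))))
| CAs3_rule9 : CAs3_rule
    ((x * (x * x)) * (x * (x * (x * (x * x)))))
    ((x * x) * (x * (x * (x * ((x * x) * x)))))
| CAs3_rule10 : CAs3_rule
    (x * (x * (x * (x * ((x * x) * (x * x))))))
    (x * (x * (x * (x * (x * ((x * x) * x))))))
| CAs3_rule11 : CAs3_rule
    ((x * x) * (x * (x * ((x * x) * (x * x)))))
    ((x * x) * (x * (x * (x * ((x * x) * x))))).

Definition CAs3_avoider (u : tree) : Prop :=
  forall s s', CAs3_rule s s' -> avoids u s.

(* Main.v *)
From Stdlib Require Import Wellfounded.
From HB Require Import structures.
From mathcomp Require Import all_boot zify.
Require Import Defs.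

(** The normal forms of a terminating and confluent rewrite relation form a
    system of representatives for the equivalence that it generates, so all
    comes down to three facts about the eleven rules: they terminate, they are
    confluent, and they generate the same congruence as the first of them.

    Termination: order trees of equal arity by comparing first the arities of
    their left subtrees, then lexicographically the left and the right subtrees
    themselves. This is a well-founded order ([smaller_wf]), it passes to
    contexts, and it passes to substitution instances ([smaller_ccomp]) because
    a comparison between arities of left subtrees is a comparison between
    prefixes of one and the same list of leaves. Thus it suffices that each of
    the eleven pairs be decreasing, a computation.

    Confluence: by Newman's lemma only local confluence is needed. Rules are
    linear with their leaves in the same order on both sides, and since there is
    a single binary generator, any two patterns have a least common instance,
    the union [sup] of their shapes. So a peak in which a rule is applied at the
    root and another rule somewhere in the tree is either two independent
    steps, or an instance of a step in the superposition of two left-hand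
    members ([step_ccomp_inv]). There are finitely many superpositions; that
    the two reducts of each have a common reduct is checked by normalizing both
    ([CAs3_critical_pairs]).

    Congruence: rewriting in both directions generates an operad congruence
    ([step_closure_cong]), and it is contained in each congruence that contains
    the rules ([cong_steps]). It remains to derive the last ten rules from the
    first, which amounts to connecting the two members of each rule by
    exchanges of left and right combs inside a tree; an exhaustive exploration
    from the left-hand member reaches the right-hand one
    ([CAs3_rules_connected]). *)

Set Implicit Arguments.
Unset Strict Implicit.
Unset Printing Implicit Defensive.

(** * Abstract rewriting *)

Definition joinable (T : Type) (R : relation T) (t u : T) : Prop :=
  exists w, clos_refl_trans T R t w /\ clos_refl_trans T R u w.

Lemma joinable_sym (T : Type) (R : relation T) t u : joinable R t u -> joinable R u t.
Proof. by case=> w [tw uw]; exists w. Qed.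

Section Newman.

Variables (T : Type) (R : relation T).
Notation steps := (clos_refl_trans T R).

Hypothesis R_wf : well_founded (fun u t => R t u).
Hypothesis R_lc : forall t u v, R t u -> R t v -> joinable R u v.

(** Given a peak with first steps to [u1] and [v1], join these by local
    confluence, then use the induction hypothesis at [u1] and at [v1]. *)
Lemma newman t u v : steps t u -> steps t v -> joinable R u v.
Proof.
elim/(well_founded_ind R_wf): t u v => t IH u v.
move=> /clos_rt_rt1n_iff tu /clos_rt_rt1n_iff tv.
case: tu => [|u1 {}u tu1 /clos_rt_rt1n_iff u1u].
  by exists v; split; [apply/clos_rt_rt1n_iff | apply: rt_refl].
case: tv => [|v1 {}v tv1 /clos_rt_rt1n_iff v1v].
  by exists u; split; [apply: rt_refl | apply: rt_trans u1u; apply: rt_step].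
have [w1 [u1w1 v1w1]] := R_lc tu1 tv1.
have [w2 [uw2 w1w2]] := IH _ tu1 _ _ u1u u1w1.
have [w [w2w vw]] := IH _ tv1 _ _ (rt_trans _ _ _ _ _ v1w1 w1w2) v1v.
by exists w; split=> //; apply: rt_trans w2w.
Qed.

End Newman.

Lemma church_rosser (T : Type) (R : relation T) :
  (forall t u v, clos_refl_trans T R t u -> clos_refl_trans T R t v ->
     joinable R u v) ->
  forall t u, clos_refl_sym_trans T R t u -> joinable R t u.
Proof.
move=> conf t u; elim=> {t u}.
- by move=> t u tu; exists u; split; [apply: rt_step | apply: rt_refl].
- by move=> t; exists t; split; apply: rt_refl.
- by move=> t u _; apply: joinable_sym.
- move=> t u v _ [w1 [tw1 uw1]] _ [w2 [uw2 vw2]].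
  have [w [w1w w2w]] := conf _ _ _ uw1 uw2.
  by exists w; split; [apply: rt_trans w1w | apply: rt_trans w2w].
Qed.

(** By induction along the well-founded order, no element occurs in an infinite
    sequence of steps: its successor there would occur too. *)
Lemma wf_terminating (T : Type) (R : relation T) : well_founded (fun u t => R t u) ->
  ~ exists f : nat -> T, forall n, R (f n) (f n.+1).
Proof.
move=> wf [f Rf]; suff: forall t n, f n <> t by move/(_ (f 0) 0).
by elim/(well_founded_ind wf) => t IH n ft; apply: (IH (f n.+1)) erefl; rewrite -ft.
Qed.

Lemma rt_mono (T : Type) (R S : relation T) : (forall t u, R t u -> S t u) ->
  forall t u, clos_refl_trans T R t u -> clos_refl_trans T S t u.
Proof.
move=> RS t u; elim=> {t u} [t u /RS|t|t u v _ + _].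
- exact: rt_step.
- exact: rt_refl.
- exact: rt_trans.
Qed.

Lemma rst_mono (T : Type) (R S : relation T) : (forall t u, R t u -> S t u) ->
  forall t u, clos_refl_sym_trans T R t u -> clos_refl_sym_trans T S t u.
Proof.
move=> RS t u; elim=> {t u} [t u /RS|t|t u _|t u v _ + _].
- exact: rst_step.
- exact: rst_refl.
- exact: rst_sym.
- exact: rst_trans.
Qed.

(** * Trees and substitution at the leaves *)

Fixpoint tree_eqb (s t : tree) : bool :=
  match s, t with
  | Leaf, Leaf => true
  | Node a b, Node c d => tree_eqb a c && tree_eqb b d
  | _, _ => false
  end.

Lemma tree_eqbP : Equality.axiom tree_eqb.
Proof.
elim=> [|a IHa b IHb] [|c d] /=; try by constructor.
by apply: (iffP andP) => [[/IHa-> /IHb->]|[<- <-]] //; split; [apply/IHa | apply/IHb].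
Qed.

HB.instance Definition _ := hasDecEq.Build tree tree_eqbP.

Lemma arity_gt0 t : 0 < arity t.
Proof. by elim: t => //= l IHl r _; rewrite addn_gt0 IHl. Qed.

Definition arities (rs : seq tree) : nat := sumn (map arity rs).

Lemma arities_cat rs qs : arities (rs ++ qs) = arities rs + arities qs.
Proof. by rewrite /arities map_cat sumn_cat. Qed.

Lemma arities_cons r rs : arities (r :: rs) = arity r + arities rs.
Proof. by []. Qed.

Lemma ccomp_cat a b ra rb : size ra = arity a ->
  ccomp (Node a b) (ra ++ rb) = Node (ccomp a ra) (ccomp b rb).
Proof. by move=> sz /=; rewrite -sz take_size_cat ?drop_size_cat. Qed.

Lemma split_args a b (rs : seq tree) : size rs = arity (Node a b) ->
  exists ra rb, [/\ rs = ra ++ rb, size ra = arity a & size rb = arity b].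
Proof.
move=> /= sz; exists (take (arity a) rs), (drop (arity a) rs).
by rewrite cat_take_drop size_drop size_takel sz ?leq_addr // addKn.
Qed.

(** A list of arguments with a distinguished entry, to be distributed over the two
    subtrees of a node: the entry falls either on the left or on the right. *)
Variant split_hole_spec m n (p q : seq tree) : Prop :=
  | HoleLeft q1 q2 of q = q1 ++ q2 & (size p + (size q1).+1 = m) & size q2 = n
  | HoleRight p1 p2 of p = p1 ++ p2 & size p1 = m & (size p2 + (size q).+1 = n).

Lemma split_hole m n p q : size p + (size q).+1 = m + n -> split_hole_spec m n p q.
Proof.
move=> sz; case: (ltnP (size p) m) => ltpm.
  apply: (@HoleLeft _ _ _ _ (take (m - (size p).+1) q) (drop (m - (size p).+1) q)).
  - by rewrite cat_take_drop.
  - by rewrite size_takel; lia.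
  - by rewrite size_drop; lia.
apply: (@HoleRight _ _ _ _ (take m p) (drop m p)).
- by rewrite cat_take_drop.
- by rewrite size_takel.
- by rewrite size_drop; lia.
Qed.

Lemma arity_ccomp s rs : size rs = arity s -> arity (ccomp s rs) = arities rs.
Proof.
elim: s rs => [|a IHa b IHb] rs.
  by case: rs => [|r []] //= _; rewrite /arities /= addn0.
by case/split_args=> ra [rb [-> sa sb]]; rewrite ccomp_cat //= IHa // IHb // arities_cat.
Qed.

(** Partial composition is the substitution of a single argument; the position of
    the leaf counts the leaves of the arguments to its left. *)
Lemma pcomp_ccomp s p r q : size p + (size q).+1 = arity s ->
  ccomp s (p ++ r :: q) = pcomp (ccomp s (p ++ Leaf :: q)) (arities p).+1 r.
Proof.
elim: s p q => [|a IHa b IHb] p q; first by case: p q => [|? []] //= [].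
case/split_hole=> [q1 q2 -> sz1 sz2|p1 p2 -> sz1 sz2].
- have szn t : size (p ++ t :: q1) = arity a by rewrite size_cat.
  rewrite -!cat_cons !catA !ccomp_cat // IHa //=.
  by rewrite arity_ccomp // arities_cat arities_cons /= ifT //; lia.
- rewrite -!catA !ccomp_cat //= arity_ccomp // IHb // arities_cat.
  by rewrite leqNgt ltnS leq_addr /= -addnS addKn.
Qed.

Lemma ccomp_nseq t : ccomp t (nseq (arity t) Leaf) = t.
Proof.
elim: t => //= l IHl r IHr.
by rewrite nseqD take_size_cat ?drop_size_cat ?size_nseq // IHl IHr.
Qed.

Lemma arities_nseq n : arities (nseq n Leaf) = n.
Proof. by elim: n => //= n IH; rewrite arities_cons IH. Qed.

Lemma pcompE t i s : 0 < i <= arity t ->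
  pcomp t i s = ccomp t (nseq i.-1 Leaf ++ s :: nseq (arity t - i) Leaf).
Proof.
case/andP=> i0 it; have sz : i.-1 + (arity t - i).+1 = arity t by lia.
rewrite pcomp_ccomp ?size_nseq // arities_nseq prednK //.
by rewrite -[Leaf :: _]/(nseq _.+1 Leaf) -nseqD sz ccomp_nseq.
Qed.

(** Substitution into the trees of a list whose leaves are numbered consecutively;
    it is the list of arguments that makes [ccomp] associative. *)
Fixpoint graft (rs qs : seq tree) : seq tree :=
  if rs is r :: rs' then
    ccomp r (take (arity r) qs) :: graft rs' (drop (arity r) qs)
  else [::].

Lemma size_graft rs qs : size (graft rs qs) = size rs.
Proof. by elim: rs qs => //= r rs IH qs; rewrite IH. Qed.

Lemma graft_cat rs1 rs2 qs1 qs2 : size qs1 = arities rs1 ->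
  graft (rs1 ++ rs2) (qs1 ++ qs2) = graft rs1 qs1 ++ graft rs2 qs2.
Proof.
elim: rs1 qs1 => [|r rs1 IH] qs1; first by move/size0nil->.
rewrite arities_cons => sz /=; rewrite take_cat drop_cat.
case: ltnP => lts; first by rewrite IH // size_drop sz addKn.
have sz1 : size qs1 = arity r by lia.
have sz2 : arities rs1 = 0 by lia.
rewrite sz1 subnn take0 drop0 cats0 -sz1 take_size drop_size.
by rewrite -IH //=.
Qed.

Lemma ccompA s rs qs : size rs = arity s -> size qs = arities rs ->
  ccomp (ccomp s rs) qs = ccomp s (graft rs qs).
Proof.
elim: s rs qs => [|a IHa b IHb] rs qs.
  case: rs => [|r []] //= _; rewrite /arities /= addn0 => sz.
  by rewrite -sz take_size.
case/split_args=> ra [rb [-> sa sb]].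
rewrite arities_cat -(arity_ccomp sa) -(arity_ccomp sb) ccomp_cat //.
case/(@split_args (ccomp a ra) (ccomp b rb)) => qa [qb [-> ta tb]].
rewrite ccomp_cat //; rewrite !arity_ccomp // in ta tb.
by rewrite graft_cat // ccomp_cat ?size_graft // IHa ?IHb.
Qed.

(** * Patterns *)

Fixpoint below (s t : tree) : bool :=
  match s, t with
  | Leaf, _ => true
  | Node a b, Node c d => below a c && below b d
  | Node _ _, Leaf => false
  end.

Fixpoint residuals (s t : tree) : seq tree :=
  match s, t with
  | Leaf, _ => [:: t]
  | Node a b, Node c d => residuals a c ++ residuals b d
  | Node _ _, Leaf => [::]
  end.

Lemma size_residuals s t : below s t -> size (residuals s t) = arity s.
Proof.
elim: s t => [|a IHa b IHb] [|c d] //= /andP[ac bd].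
by rewrite size_cat IHa ?IHb.
Qed.

Lemma ccomp_residuals s t : below s t -> ccomp s (residuals s t) = t.
Proof.
elim: s t => [|a IHa b IHb] [|c d] // /andP[ac bd].
by rewrite [residuals _ _]/= ccomp_cat ?size_residuals // IHa ?IHb.
Qed.

Lemma arities_residuals s t : below s t -> arities (residuals s t) = arity t.
Proof. by move=> st; rewrite -(arity_ccomp (size_residuals st)) ccomp_residuals. Qed.

Lemma below_ccomp s rs : size rs = arity s -> below s (ccomp s rs).
Proof.
elim: s rs => [|a IHa b IHb] rs //.
by case/split_args=> ra [rb [-> sa sb]]; rewrite ccomp_cat //= IHa ?IHb.
Qed.

Lemma residuals_ccomp s rs : size rs = arity s -> residuals s (ccomp s rs) = rs.
Proof.
elim: s rs => [|a IHa b IHb] rs; first by case: rs => [|r []].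
by case/split_args=> ra [rb [-> sa sb]]; rewrite ccomp_cat //= IHa ?IHb.
Qed.

Lemma ccomp_inj s rs qs : size rs = arity s -> size qs = arity s ->
  ccomp s rs = ccomp s qs -> rs = qs.
Proof. by move=> sr sq e; rewrite -(residuals_ccomp sr) e residuals_ccomp. Qed.

(** The least common instance of two patterns. It always exists: a leaf imposes
    nothing and two nodes never clash. *)
Fixpoint sup (s t : tree) : tree :=
  match s, t with
  | Leaf, _ => t
  | _, Leaf => s
  | Node a b, Node c d => Node (sup a c) (sup b d)
  end.

Lemma below_refl s : below s s.
Proof. by elim: s => //= a -> b ->. Qed.

Lemma below_supl s t : below s (sup s t).
Proof. by elim: s t => [|a IHa b IHb] [|c d] //=; rewrite ?below_refl ?IHa ?IHb. Qed.

Lemma below_supr s t : below t (sup s t).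
Proof. by elim: s t => [|a IHa b IHb] [|c d] //=; rewrite ?below_refl ?IHa ?IHb. Qed.

Lemma sup_below s t u : below s u -> below t u -> below (sup s t) u.
Proof.
elim: s t u => [|a IHa b IHb] [|c d] [|e f] //= /andP[ae bf] /andP[ce df].
by rewrite IHa ?IHb.
Qed.

(** * One-step rewriting *)

Definition arity_preserving (R : relation tree) : Prop :=
  forall s s', R s s' -> arity s = arity s'.

(** Rewriting with the context given one node at a time, which allows inductions
    on the position of the redex. *)
Inductive step (R : relation tree) : tree -> tree -> Prop :=
  | StepRoot s s' rs of R s s' & size rs = arity s :
      step R (ccomp s rs) (ccomp s' rs)
  | StepLeft l l' r of step R l l' : step R (Node l r) (Node l' r)
  | StepRight l r r' of step R r r' : step R (Node l r) (Node l r').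

Lemma step_rewrite R t u : step R t u <-> rewrite R t u.
Proof.
split; first elim=> {t u}.
- by move=> s s' rs Rss sz; exists Leaf, 1, s, s', rs.
- move=> l l' r _ [c [i [s [s' [rs [Rss /andP[i0 i1] sz -> ->]]]]]].
  exists (Node c r), i, s, s', rs; rewrite /= i1; split=> //.
  by rewrite i0 (leq_trans i1) ?leq_addr.
- move=> l r r' _ [c [i [s [s' [rs [Rss /andP[i0 i1] sz -> ->]]]]]].
  exists (Node l c), (arity l + i), s, s', rs.
  have il : (arity l + i <= arity l) = false by lia.
  by rewrite /= il addKn; split=> //; lia.
case=> c [i [s [s' [rs [Rss /andP[i0 i1] sz -> ->]]]]] {t u}.
elim: c i i0 i1 => [|l IHl r IHr] i i0 /= i1.
  have -> : i = 1 by lia.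
  exact: StepRoot.
case: leqP => il; first by apply: StepLeft; apply: IHl.
by apply: StepRight; apply: IHr; lia.
Qed.

Section Steps.

Variable R : relation tree.
Hypothesis R_arity : arity_preserving R.

Notation steps := (clos_refl_trans tree (step R)).

Lemma step_arity t u : step R t u -> arity t = arity u.
Proof.
elim=> {t u} [s s' rs Rss sz|l l' r _ /= ->|l r r' _ /= ->] //.
by rewrite !arity_ccomp // -(R_arity Rss).
Qed.

(** Both sides of a rewriting step have their leaves in the same order, so the
    same arguments can be substituted in both. *)
Lemma step_ccomp t u qs : step R t u -> size qs = arity t ->
  step R (ccomp t qs) (ccomp u qs).
Proof.
move=> tu; elim: tu qs => {t u} [s s' rs Rss sz|l l' r ll' IH|l r r' rr' IH] qs.
- rewrite arity_ccomp // => szq; rewrite !ccompA -?(R_arity Rss) //.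
  by apply: StepRoot; rewrite ?size_graft.
- case/split_args=> ql [qr [-> sl sr]]; rewrite !ccomp_cat // -?(step_arity ll') //.
  by apply: StepLeft; apply: IH.
- case/split_args=> ql [qr [-> sl sr]]; rewrite !ccomp_cat //.
  by apply: StepRight; apply: IH.
Qed.

Lemma step_arg s p q r r' : size p + (size q).+1 = arity s -> step R r r' ->
  step R (ccomp s (p ++ r :: q)) (ccomp s (p ++ r' :: q)).
Proof.
move=> + rr'; elim: s p q => [|a IHa b IHb] p q; first by case: p q => [|? []] //= [].
case/split_hole=> [q1 q2 -> sz1 sz2|p1 p2 -> sz1 sz2].
- rewrite -!cat_cons !catA !ccomp_cat ?size_cat //.
  by apply: StepLeft; apply: IHa.
- by rewrite -!catA !ccomp_cat //; apply: StepRight; apply: IHb.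
Qed.

(** [P] is an invariant of rewriting, such as the arity, under which [f] transports
    steps. *)
Lemma steps_map (f : tree -> tree) (P : tree -> Prop) :
  (forall t u, step R t u -> P t -> step R (f t) (f u) /\ P u) ->
  forall t u, steps t u -> P t -> steps (f t) (f u) /\ P u.
Proof.
move=> fP t u; elim=> {t u} [t u tu Pt|t Pt|t u v _ IH1 _ IH2 Pt].
- by case: (fP t u tu Pt) => ? ?; split=> //; apply: rt_step.
- by split=> //; apply: rt_refl.
- by case: (IH1 Pt) => tu /IH2[uv Pv]; split=> //; apply: rt_trans uv.
Qed.

Lemma steps_left l l' r : steps l l' -> steps (Node l r) (Node l' r).
Proof.
move=> ll'; have [] // := steps_map (f := fun t => Node t r) (P := fun=> True) _ ll'.
by move=> t u tu _; split=> //; apply: StepLeft.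
Qed.

Lemma steps_right l r r' : steps r r' -> steps (Node l r) (Node l r').
Proof.
move=> rr'; have [] // := steps_map (f := Node l) (P := fun=> True) _ rr'.
by move=> t u tu _; split=> //; apply: StepRight.
Qed.

Lemma steps_ccomp t u qs : steps t u -> size qs = arity t ->
  steps (ccomp t qs) (ccomp u qs).
Proof.
move=> tu sz.
have [] // := steps_map (f := ccomp^~ qs) (P := fun t => size qs = arity t) _ tu.
move=> {}t {}u {}tu {}sz; split; first exact: step_ccomp.
by rewrite -(step_arity tu).
Qed.

End Steps.

Definition rel_of (rl : seq (tree * tree)) : relation tree :=
  fun s s' => (s, s') \in rl.

Definition contract (p : tree * tree) (t : tree) : tree :=
  ccomp p.2 (residuals p.1 t).

Lemma arity_contract rl p t : arity_preserving (rel_of rl) -> p \in rl ->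
  below p.1 t -> arity (contract p t) = arity t.
Proof.
case: p => s s' ar /ar /= es st.
by rewrite /contract arity_ccomp -?es ?size_residuals ?arities_residuals.
Qed.

Definition contractions (rl : seq (tree * tree)) (t : tree) : seq tree :=
  [seq contract p t | p <- rl & below p.1 t].

Lemma contractions_step rl t u : u \in contractions rl t -> step (rel_of rl) t u.
Proof.
case/mapP=> -[s s']; rewrite mem_filter => /andP[/= st Rss] ->.
rewrite -{1}(ccomp_residuals st); apply: StepRoot; first exact: Rss.
exact: size_residuals.
Qed.

Fixpoint reducts (rl : seq (tree * tree)) (t : tree) : seq tree :=
  contractions rl t ++
  (if t is Node l r then
     [seq Node l' r | l' <- reducts rl l] ++ [seq Node l r' | r' <- reducts rl r]
   else [::]).

(** Rewriting by a finite set of rules is decidable; this makes the later checks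
    computations. *)
Lemma reductsP rl t u : reflect (step (rel_of rl) t u) (u \in reducts rl t).
Proof.
apply: (iffP idP) => [|tu].
- elim: t u => [|l IHl r IHr] u; first by rewrite /= cats0; apply: contractions_step.
  rewrite mem_cat => /orP[/contractions_step //|].
  rewrite mem_cat => /orP[] /mapP[v + ->].
  + by move/IHl; apply: StepLeft.
  + by move/IHr; apply: StepRight.
- elim: tu => {t u} [s s' rs Rss sz|l l' r _ IH|l r r' _ IH].
  + suff: ccomp s' rs \in contractions rl (ccomp s rs).
      by case: (ccomp s rs) => *; rewrite mem_cat; apply/orP; left.
    apply/mapP; exists (s, s'); last by rewrite /contract /= residuals_ccomp.
    by rewrite mem_filter below_ccomp.
  + by rewrite !mem_cat (map_f (fun t => Node t r) IH) orbT.
  + by rewrite !mem_cat (map_f (Node l) IH) !orbT.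
Qed.

(** * Termination *)

(** At the first node, in prefix order, where the two members of a rule differ,
    leaves have moved from the left to the right subtree. *)
Fixpoint tlt (u t : tree) : bool :=
  match u, t with
  | Node a b, Node c d =>
      (arity a < arity c) ||
      (arity a == arity c) && (tlt a c || (a == c) && tlt b d)
  | _, _ => false
  end.

(** Without the restriction to equal arities there would be infinite descents:
    grafting a tree as the right child of a new root with a leaf on its left,
    again and again, produces smaller and smaller trees from [(x * x) * x]. *)
Definition smaller (u t : tree) : Prop := arity u = arity t /\ tlt u t.

Lemma smaller_left l' l r : smaller l' l -> smaller (Node l' r) (Node l r).
Proof. by case=> /= e lt; split; rewrite /= e // eqxx lt orbT. Qed.

Lemma smaller_right l r' r : smaller r' r -> smaller (Node l r') (Node l r).
Proof. by case=> /= e lt; split; rewrite /= ?e // !eqxx lt !orbT. Qed.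

(** Below a node [Node l r] the arity of the left subtree decreases, or the left
    subtree decreases, or the right one does: a triple lexicographic induction,
    inside an induction on the arity that makes the subtrees accessible. *)
Lemma smaller_wf : well_founded smaller.
Proof.
suff wf n t : arity t < n -> Acc smaller t by move=> t; apply: (wf (arity t).+1).
elim: n t => [|n IHn] t; first by rewrite ltn0.
case: t => [|l r] ltn; first by constructor=> u [_]; case: u.
rewrite ltnS /= in ltn.
have al := arity_gt0 l; have ar := arity_gt0 r.
suff: forall k l r, arity l < k -> arity l + arity r <= n -> Acc smaller (Node l r).
  by move/(_ (arity l).+1 l r (ltnSn _)); apply.
elim=> [|k IHk] {al ar ltn}l {}r; first by rewrite ltn0.
rewrite ltnS => lelk len.
have al := arity_gt0 l; have ar := arity_gt0 r.
have Al : Acc smaller l by apply: IHn; lia.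
have Ar : Acc smaller r by apply: IHn; lia.
elim: Al r Ar {al ar} len lelk => {}l _ IHl r; elim=> {}r Ar IHr len lelk.
constructor=> u [+ lt]; case: u lt => [//|l' r'] /= lt e.
have l'0 := arity_gt0 l'; have r'0 := arity_gt0 r'.
case/orP: lt => [ltl|/andP[/eqP el /orP[ltl|/andP[/eqP ell ltr]]]].
- by apply: IHk; lia.
- apply: IHl; [by split | by apply: IHn; lia | by lia | by lia].
- rewrite ell in e *; apply: IHr; [by split=> //; lia | by lia | by []].
Qed.

Lemma ltn_arities_take m n (rs : seq tree) : m < n <= size rs ->
  arities (take m rs) < arities (take n rs).
Proof.
case/andP=> mn ns; rewrite -(subnKC (ltnW mn)) takeD arities_cat -[ltnLHS]addn0 ltn_add2l.
case E: (take _ _) => [|r qs]; last by rewrite arities_cons addn_gt0 arity_gt0.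
by have := congr1 size E; rewrite size_take size_drop /=; case: ifP; lia.
Qed.

(** At the first node where [s'] and [s] differ, the left subtree of [s'] covers a
    shorter prefix of the leaves than that of [s]; arguments have positive
    arities, so the same holds after substitution. *)
Lemma smaller_ccomp s' s rs : smaller s' s -> size rs = arity s ->
  smaller (ccomp s' rs) (ccomp s rs).
Proof.
move=> [e lt] sz; split; first by rewrite !arity_ccomp // e.
elim: s' s rs e lt sz => [|a IHa b IHb] [|c d] rs //= e lt sz.
have as_t t n : n = arity t -> n <= size rs ->
    arity (ccomp t (take n rs)) = arities (take n rs).
  by move=> -> lers; rewrite arity_ccomp ?size_takel.
rewrite !as_t //; try lia.
case/orP: lt => [ltac|/andP[/eqP eac lt]].
  by rewrite ltn_arities_take //; lia.
rewrite eac eqxx /=; case/orP: lt => [ltac|/andP[/eqP <- ltbd]].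
  by rewrite IHa ?orbT ?size_takel //; lia.
by rewrite eqxx IHb ?orbT //; [|rewrite size_drop]; lia.
Qed.

Lemma step_smaller (R : relation tree) : (forall s s', R s s' -> smaller s' s) ->
  forall t u, step R t u -> smaller u t.
Proof.
move=> Rs t u; elim=> {t u} [s s' rs Rss sz|l l' r _|l r r' _].
- exact: smaller_ccomp (Rs _ _ Rss) sz.
- exact: smaller_left.
- exact: smaller_right.
Qed.

(** * Critical pairs *)

(** The superpositions of [s] with a left-hand member placed at a node of [s], each
    with its reduct at that place. *)
Fixpoint overlaps (rl : seq (tree * tree)) (s : tree) : seq (tree * tree) :=
  if s is Node a b then
    [seq (sup s p.1, contract p (sup s p.1)) | p <- rl] ++
    [seq (Node m.1 b, Node m.2 b) | m <- overlaps rl a] ++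
    [seq (Node a m.1, Node a m.2) | m <- overlaps rl b]
  else [::].

Lemma overlaps_below rl s m : m \in overlaps rl s -> below s m.1.
Proof.
elim: s m => [|a IHa b IHb] m // /=; rewrite !mem_cat.
case/or3P=> /mapP[p pin -> /=]; last 2 first.
- by rewrite IHa // below_refl.
- by rewrite IHb // below_refl.
exact: (below_supl (Node a b)).
Qed.

Lemma overlaps_arity rl s m : arity_preserving (rel_of rl) ->
  m \in overlaps rl s -> arity m.2 = arity m.1.
Proof.
move=> ar; elim: s m => [|a IHa b IHb] m // /=; rewrite !mem_cat.
case/or3P=> /mapP[p pin -> /=]; [|by rewrite IHa|by rewrite IHb].
exact: (arity_contract ar pin (below_supr (Node a b) p.1)).
Qed.

(** A redex at the root of an instance of [s] is also an instance of the least
    common instance of [s] and the left-hand member, hence the step lifts to a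
    step from the latter. *)
Lemma step_root_sup rl s l l' rs qs : arity_preserving (rel_of rl) ->
  rel_of rl l l' -> size rs = arity s -> size qs = arity l ->
  ccomp s rs = ccomp l qs ->
  exists xs, [/\ size xs = arity (sup s l), ccomp s rs = ccomp (sup s l) xs &
    ccomp l' qs = ccomp (contract (l, l') (sup s l)) xs].
Proof.
move=> ar Rll szr szq eqt.
have st : below (sup s l) (ccomp s rs).
  by apply: sup_below; rewrite ?below_ccomp // eqt below_ccomp.
exists (residuals (sup s l) (ccomp s rs)).
rewrite size_residuals // ccomp_residuals //; split=> //.
have lm := below_supr s l.
rewrite /contract /= ccompA -?(ar _ _ Rll) ?size_residuals ?arities_residuals //.
congr ccomp; apply: (@ccomp_inj l); rewrite ?size_graft ?size_residuals //.
by rewrite -ccompA ?size_residuals ?arities_residuals // !ccomp_residuals.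
Qed.

(** A redex in an instance of [s] has its root either inside one of the arguments
    or at a node of [s]; in the second case the step is an instance of one of
    the [overlaps]. *)
Lemma step_ccomp_inv rl s rs v : arity_preserving (rel_of rl) ->
  size rs = arity s -> step (rel_of rl) (ccomp s rs) v ->
  (exists p r r' q, [/\ rs = p ++ r :: q, step (rel_of rl) r r' &
     v = ccomp s (p ++ r' :: q)]) \/
  (exists m qs, [/\ m \in overlaps rl s, size qs = arity m.1,
     ccomp s rs = ccomp m.1 qs & v = ccomp m.2 qs]).
Proof.
move=> ar; elim: s rs v => [|a IHa b IHb] rs v.
  by case: rs => [|r []] //= _ rv; left; exists [::], r, v, [::].
case/split_args=> ra [rb [-> sa sb]] st.
have sz : size (ra ++ rb) = arity (Node a b) by rewrite size_cat sa sb.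
move eqt: (ccomp _ _) st => t st; case: st eqt => {t v}.
- move=> l l' qs Rll szq eqt; right.
  have [xs [sx tx vx]] := step_root_sup ar Rll sz szq eqt.
  exists (sup (Node a b) l, contract (l, l') (sup (Node a b) l)), xs.
  split=> //; last by rewrite -eqt.
  by rewrite mem_cat; apply/orP; left; apply/mapP; exists (l, l').
- move=> l l' r ll'; rewrite ccomp_cat // => -[el <-]; rewrite -{l}el in ll' *.
  case: (IHa ra l' sa ll') => [[p [x [x' [q [era xx' ->]]]]]|[m [qs [min szq el ->]]]].
    left; exists p, x, x', (q ++ rb); rewrite era -catA; split=> //.
    rewrite -cat_cons catA ccomp_cat // -sa era !size_cat //.
  right; exists (Node m.1 b, Node m.2 b), (qs ++ rb); split.
  + by rewrite !mem_cat (map_f (fun m => (Node m.1 b, Node m.2 b)) min) orbT.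
  + by rewrite size_cat szq sb.
  + by rewrite ccomp_cat // el.
  + by rewrite ccomp_cat // (overlaps_arity ar min).
- move=> l r r' rr'; rewrite ccomp_cat // => -[<- er]; rewrite -{r}er in rr' *.
  case: (IHb rb r' sb rr') => [[p [x [x' [q [erb xx' ->]]]]]|[m [qs [min szq er ->]]]].
    left; exists (ra ++ p), x, x', q; rewrite erb -catA; split=> //.
    by rewrite -catA ccomp_cat.
  right; exists (Node a m.1, Node a m.2), (ra ++ qs); split.
  + by rewrite !mem_cat (map_f (fun m => (Node a m.1, Node a m.2)) min) !orbT.
  + by rewrite size_cat szq sa.
  + by rewrite ccomp_cat // er.
  + by rewrite ccomp_cat.
Qed.

Section CriticalPairs.

Variable rl : seq (tree * tree).
Hypothesis rl_arity : arity_preserving (rel_of rl).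

Notation stepl := (step (rel_of rl)).

Definition critical_pairs_joinable : Prop :=
  forall p m, p \in rl -> m \in overlaps rl p.1 ->
    joinable stepl (contract p m.1) m.2.

Hypothesis cpj : critical_pairs_joinable.

(** A step inside an argument commutes with the step at the root. Otherwise the
    peak is an instance of a critical pair, and joins of the pair can be
    instantiated. *)
Lemma peak_root s s' rs v : rel_of rl s s' -> size rs = arity s ->
  stepl (ccomp s rs) v -> joinable stepl (ccomp s' rs) v.
Proof.
move=> Rss sz /(step_ccomp_inv rl_arity sz).
case=> [[p [x [x' [q [ers xx' ->]]]]]|[m [qs [min szq et ->]]]].
- exists (ccomp s' (p ++ x' :: q)); split; apply: rt_step.
    by rewrite ers; apply: step_arg xx'; rewrite -(rl_arity Rss) -sz ers size_cat.
  by apply: StepRoot; rewrite // -sz ers !size_cat.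
- have sm := overlaps_below min; have Sm := size_residuals sm.
  have am := arity_contract rl_arity Rss sm.
  have [w [uw vw]] := cpj Rss min.
  have er : rs = graft (residuals s m.1) qs.
    apply: (@ccomp_inj s); rewrite ?size_graft // -ccompA ?arities_residuals //.
    by rewrite ccomp_residuals.
  exists (ccomp w qs); split; last first.
    by apply: (steps_ccomp rl_arity vw); rewrite (overlaps_arity rl_arity min).
  rewrite er -ccompA -?(rl_arity Rss) ?arities_residuals //.
  by apply: (steps_ccomp rl_arity uw); rewrite am.
Qed.

Lemma joinable_left l l' r : joinable stepl l l' ->
  joinable stepl (Node l r) (Node l' r).
Proof. by case=> w [lw l'w]; exists (Node w r); split; apply: steps_left. Qed.

Lemma joinable_right l r r' : joinable stepl r r' ->
  joinable stepl (Node l r) (Node l r').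
Proof. by case=> w [rw r'w]; exists (Node l w); split; apply: steps_right. Qed.

(** Induction on the position of the first redex: steps in different subtrees of a
    node commute, and a peak with a redex at the root is [peak_root]. *)
Lemma local_confluence t u v : stepl t u -> stepl t v -> joinable stepl u v.
Proof.
move=> tu; elim: tu v => {t u} [s s' rs Rss sz|l l' r ll' IH|l r r' rr' IH] v.
- exact: peak_root.
- move et: (Node l r) => t tv; case: tv et => {t v}.
  + move=> s s' rs Rss sz et; apply: joinable_sym; apply: (peak_root Rss sz).
    by rewrite -et; apply: StepLeft.
  + by move=> l1 l2 r1 ll [el <-]; apply/joinable_left/IH; rewrite el.
  + move=> l1 r1 r2 rr [<- er]; exists (Node l' r2); rewrite -er in rr.
    by split; apply: rt_step; [apply: StepRight | apply: StepLeft].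
- move et: (Node l r) => t tv; case: tv et => {t v}.
  + move=> s s' rs Rss sz et; apply: joinable_sym; apply: (peak_root Rss sz).
    by rewrite -et; apply: StepRight.
  + move=> l1 l2 r1 ll [el <-]; exists (Node l2 r'); rewrite -el in ll.
    by split; apply: rt_step; [apply: StepLeft | apply: StepRight].
  + by move=> l1 r1 r2 rr [<- er]; apply/joinable_right/IH; rewrite er.
Qed.

End CriticalPairs.

Definition reduce (n : nat) rl (t : tree) : tree :=
  iter n (fun u => head u (reducts rl u)) t.

Lemma reduce_steps n rl t : clos_refl_trans tree (step (rel_of rl)) t (reduce n rl t).
Proof.
elim: n => [|n IH] /=; first exact: rt_refl.
apply: rt_trans IH _; case E: (reducts rl _) => [|u us]; first exact: rt_refl.
by apply/rt_step/reductsP; rewrite E mem_head.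
Qed.

Definition check_critical_pairs (n : nat) rl : bool :=
  all (fun p => all (fun m => reduce n rl (contract p m.1) == reduce n rl m.2)
                    (overlaps rl p.1)) rl.

Lemma check_critical_pairsP n rl :
  check_critical_pairs n rl -> critical_pairs_joinable rl.
Proof.
move=> /allP chk p m /chk/allP{}chk /chk/eqP e.
by exists (reduce n rl m.2); rewrite -{1}e; split; apply: reduce_steps.
Qed.

(** * Operad congruences *)

Section Congruence.

Variable E : relation tree.
Hypothesis E_cong : operad_congruence E.

Let Erefl t : E t t. Proof. by case: (cong_equiv E_cong). Qed.
Let Etrans t u v : E t u -> E u v -> E t v.
Proof. by case: (cong_equiv E_cong) => _ tr _; apply: tr. Qed.
Let Esym t u : E t u -> E u t. Proof. by case: (cong_equiv E_cong) => _ _; apply. Qed.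

(** A node is the composite of the generator with its two subtrees. Composing at
    the second leaf first leaves the first leaf in position 1. *)
Lemma cong_node l l' r r' : E l l' -> E r r' -> E (Node l r) (Node l' r').
Proof.
move=> ll' rr'.
have xr : E (Node Leaf r) (Node Leaf r').
  exact: (@cong_pcomp _ E_cong (Node Leaf Leaf) _ _ _ 2 isT (Erefl _) rr').
exact: (@cong_pcomp _ E_cong (Node Leaf r) _ _ _ 1 isT xr ll').
Qed.

(** A complete composition is a sequence of partial ones, filling the leaves from
    left to right: the first arguments are [qs], the remaining leaves are
    still free. *)
Lemma cong_ccomp s s' rs : E s s' -> size rs = arity s -> E (ccomp s rs) (ccomp s' rs).
Proof.
move=> ss' sz; have es := cong_arity E_cong ss'.
suff: forall qs n, size qs + n = arity s ->
    E (ccomp s (qs ++ nseq n Leaf)) (ccomp s' (qs ++ nseq n Leaf)).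
  by move=> /(_ rs 0); rewrite cats0 addn0; apply.
move=> {rs sz}; elim/last_ind=> [|qs q IH] n.
  by rewrite add0n => ->; rewrite {2}es !ccomp_nseq.
rewrite size_rcons addSnnS => sz; rewrite -cats1 -catA /=.
have szq : size qs + (size (nseq n Leaf)).+1 = arity s by rewrite size_nseq.
rewrite (pcomp_ccomp _ szq); rewrite es in szq; rewrite (pcomp_ccomp _ szq).
apply: (cong_pcomp E_cong); [| exact: (IH n.+1) | exact: Erefl].
rewrite arity_ccomp ?size_cat /= ?size_nseq // arities_cat arities_cons /=; lia.
Qed.

Lemma cong_step R : (forall s s', R s s' -> E s s') ->
  forall t u, step R t u -> E t u.
Proof.
move=> RE t u; elim=> {t u} [s s' rs /RE|l l' r _ ll'|l r r' _ rr'].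
- exact: cong_ccomp.
- exact: cong_node.
- exact: cong_node.
Qed.

Lemma cong_steps R : (forall s s', R s s' -> E s s') ->
  forall t u, clos_refl_sym_trans tree (step R) t u -> E t u.
Proof.
move=> RE t u; elim=> {t u} [t u|t|t u _|t u v _ + _].
- exact: cong_step.
- exact: Erefl.
- exact: Esym.
- exact: Etrans.
Qed.

End Congruence.

(** Compatibility with [pcomp] splits into rewriting in the grafted tree, which is
    an argument of a substitution, and rewriting in the tree that receives it,
    of which the whole is an instance. *)
Lemma step_closure_cong R : arity_preserving R ->
  operad_congruence (clos_refl_sym_trans tree (step R)).
Proof.
move=> ar; set E := clos_refl_sym_trans _ _.
have Ear t u : E t u -> arity t = arity u.
  elim=> {t u} [t u|t|t u _ ->|t u v _ -> _ ->] //.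
  exact: step_arity.
split=> //.
  by split; [apply: rst_refl | apply: rst_trans | apply: rst_sym].
move=> t t' s s' i leit tt' ss'; apply: (@rst_trans _ _ _ (pcomp t i s')).
  rewrite !pcompE //.
  have : size (nseq i.-1 Leaf) + (size (nseq (arity t - i) Leaf)).+1 = arity t.
    by rewrite !size_nseq; lia.
  move: (nseq _ _) (nseq _ _) => p q sz {tt'}.
  elim: ss' => {s s'} [s s' ss'|s|s s' _|r s u _ + _].
  - by apply: rst_step; apply: step_arg.
  - exact: rst_refl.
  - exact: rst_sym.
  - exact: rst_trans.
rewrite !pcompE -?(Ear _ _ tt') //; set qs := _ ++ _.
have : size qs = arity t by rewrite /qs size_cat /= !size_nseq; lia.
move: qs => qs {ss' leit i}.
elim: tt' => {t t'} [t t' tt' sz|t|t t' tt' IH sz|r t u rt IH1 tu IH2 sz].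
- by apply: rst_step; apply: step_ccomp.
- by move=> _; apply: rst_refl.
- by apply/rst_sym/IH; rewrite (Ear _ _ tt').
- by apply: rst_trans (IH1 sz) (IH2 _); rewrite -(Ear _ _ rt).
Qed.

Fixpoint component (n : nat) rl (ts : seq tree) : seq tree :=
  if n is n'.+1 then component n' rl (undup (ts ++ flatten (map (reducts rl) ts)))
  else ts.

Lemma component_closure n rl ts (P : tree -> Prop) :
  (forall t u, step (rel_of rl) t u -> P t -> P u) ->
  {in ts, forall t, P t} -> {in component n rl ts, forall t, P t}.
Proof.
move=> Pstep; elim: n ts => //= n IH ts Pts; apply: IH => u.
rewrite mem_undup mem_cat => /orP[/Pts //|/flatten_mapP[t tts /reductsP tu]].
exact: Pstep tu (Pts _ tts).
Qed.

(** * The rewrite rule for the comb congruence *)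

Local Notation x := Leaf.

Definition CAs3_rules : seq (tree * tree) := (
  [:: ( ((x * x) * x) * x                       , x * (x * (x * x)) );
      ( (x * (x * (x * x))) * x                 , (x * x) * (x * (x * x)) );
      ( x * ((x * (x * x)) * (x * x))           , x * (x * (x * (x * (x * x)))) );
      ( x * (x * ((x * (x * x)) * x))           , x * (x * (x * (x * (x * x)))) );
      ( (x * ((x * x) * x)) * (x * (x * x))     , (x * x) * (x * (x * (x * (x * x)))) );
      ( x * ((x * x) * (x * (x * (x * x))))     , x * (x * (x * ((x * x) * (x * x)))) );
      ( x * (x * ((x * x) * (x * (x * x))))     , x * (x * (x * (x * ((x * x) * x)))) );
      ( x * (x * (x * ((x * x) * ((x * x) * x)))), x * (x * (x * (x * (x * (x * (x * x)))))) );
      ( (x * (x * x)) * (x * (x * (x * (x * x)))), (x * x) * (x * (x * (x * ((x * x) * x)))) );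
      ( x * (x * (x * (x * ((x * x) * (x * x))))), x * (x * (x * (x * (x * ((x * x) * x))))) );
      ( (x * x) * (x * (x * ((x * x) * (x * x)))), (x * x) * (x * (x * (x * ((x * x) * x)))) ) ])%tree.

Lemma CAs3_rulesP s s' : CAs3_rule s s' <-> rel_of CAs3_rules s s'.
Proof.
split; first by case.
rewrite /rel_of /CAs3_rules !inE.
by do 11?[case/orP]; move/eqP=> [-> ->]; constructor.
Qed.

Lemma CAs3_rewriteP t u : rewrite CAs3_rule t u <-> step (rel_of CAs3_rules) t u.
Proof.
rewrite step_rewrite.
split=> -[c [i [s [s' [rs [/CAs3_rulesP ss' ic sz et eu]]]]]].
  by exists c, i, s, s', rs; split.
by exists c, i, s, s', rs; split.
Qed.

Definition decreasing (p : tree * tree) : bool :=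
  (arity p.2 == arity p.1) && tlt p.2 p.1.

Lemma CAs3_rules_smaller s s' : rel_of CAs3_rules s s' -> smaller s' s.
Proof.
have /allP dec : all decreasing CAs3_rules by vm_compute.
by move=> /dec/andP[/eqP].
Qed.

Lemma CAs3_rules_arity : arity_preserving (rel_of CAs3_rules).
Proof. by move=> s s' /CAs3_rules_smaller[]. Qed.

Notation CAs3_step := (step (rel_of CAs3_rules)).

Lemma CAs3_step_wf : well_founded (fun u t => CAs3_step t u).
Proof.
apply: (@wf_incl _ _ smaller) smaller_wf => u t.
exact/step_smaller/CAs3_rules_smaller.
Qed.

(** Thirty steps suffice to bring both sides of each of these pairs to the same
    tree; their superpositions have at most fourteen leaves. *)
Lemma CAs3_critical_pairs : check_critical_pairs 30 CAs3_rules.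
Proof. by vm_compute. Qed.

Lemma CAs3_step_confluent t u v :
  clos_refl_trans tree CAs3_step t u -> clos_refl_trans tree CAs3_step t v ->
  joinable CAs3_step u v.
Proof.
apply: (newman CAs3_step_wf) => {}t {}u {}v.
apply: (local_confluence CAs3_rules_arity).
exact: check_critical_pairsP CAs3_critical_pairs.
Qed.

Definition comb_exchange : seq (tree * tree) := (
  [:: ( ((x * x) * x) * x , x * (x * (x * x)) );
      ( x * (x * (x * x)) , ((x * x) * x) * x ) ])%tree.

(** Twenty rounds suffice; the longest derivation is that of the tenth rule. *)
Lemma CAs3_rules_connected :
  all (fun p => p.2 \in component 20 comb_exchange [:: p.1]) CAs3_rules.
Proof. by vm_compute. Qed.

Lemma CAs3_rules_cong (E : relation tree) : operad_congruence E ->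
  E (((x * x) * x) * x)%tree (x * (x * (x * x)))%tree ->
  forall s s', rel_of CAs3_rules s s' -> E s s'.
Proof.
move=> Ec E1 s s' /(allP CAs3_rules_connected); rewrite [_.1]/= [_.2]/=.
have [Er Et Es] := cong_equiv Ec.
have step_E t u : step (rel_of comb_exchange) t u -> E s t -> E s u.
  move=> tu st; apply: Et st _; apply: (cong_step Ec _ tu) => {tu}{}t {}u.
  rewrite /rel_of !inE => /orP[] /eqP[-> ->] //.
  exact: Es.
by apply: (component_closure step_E) => t; rewrite inE => /eqP->.
Qed.

(** The closure is itself a congruence containing the generating pair, hence
    contains the smallest one; and each congruence containing this pair contains
    all rules. *)
Lemma CAs3_congE t u : CAs3_cong t u <-> clos_refl_sym_trans tree CAs3_step t u.
Proof.
split=> [|tu E Ec E1].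
  apply; first exact: step_closure_cong CAs3_rules_arity.
  by apply/rst_step/reductsP.
exact: (cong_steps Ec (CAs3_rules_cong Ec E1) tu).
Qed.

Lemma CAs3_cong_congruence : operad_congruence CAs3_cong.
Proof.
split.
- split=> [t|t u v tu uv|t u tu] E Ec E1; have [Er Et Es] := cong_equiv Ec.
  + exact: Er.
  + exact: Et (tu E Ec E1) (uv E Ec E1).
  + exact: Es (tu E Ec E1).
- move=> t u /CAs3_congE; exact: cong_arity (step_closure_cong CAs3_rules_arity) _ _.
- move=> t t' s s' i it tt' ss' E Ec E1.
  exact: (cong_pcomp Ec it (tt' E Ec E1) (ss' E Ec E1)).
Qed.

Lemma CAs3_convergent : convergent_orientation CAs3_rule CAs3_cong.
Proof.
split.
- split=> [s s' /CAs3_rulesP|t u]; first exact: CAs3_rules_arity.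
  by rewrite CAs3_congE; split; apply: rst_mono => {}t {}u /CAs3_rewriteP.
- case=> f ft; apply: (wf_terminating CAs3_step_wf).
  by exists f => n; apply/CAs3_rewriteP.
- move=> t u v /(rt_mono (fun t u => proj1 (CAs3_rewriteP t u))) tu.
  move=> /(rt_mono (fun t u => proj1 (CAs3_rewriteP t u))) tv.
  have [w [uw vw]] := CAs3_step_confluent tu tv; exists w.
  by split; apply: (rt_mono (fun t u => proj2 (CAs3_rewriteP t u))).
Qed.

Lemma CAs3_avoiderP u : CAs3_avoider u <-> normal_form CAs3_rule u.
Proof.
split=> [av [v [c [i [s [s' [rs [ss' ic sz eu _]]]]]]]|
         nf s s' ss' [c [i [rs [ic sz eu]]]]].
  by apply: (av s s' ss'); exists c, i, rs.
by apply: nf; exists (pcomp c i (ccomp s' rs)), c, i, s, s', rs.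
Qed.

Lemma normal_form_reducts u : normal_form CAs3_rule u <-> reducts CAs3_rules u = [::].
Proof.
split=> [nf|nil [v /CAs3_rewriteP/reductsP]]; last by rewrite nil.
case E: (reducts _ _) => [|v vs] //; case: nf; exists v.
by apply/CAs3_rewriteP/reductsP; rewrite E mem_head.
Qed.

Lemma normal_form_steps u v : normal_form CAs3_rule u ->
  clos_refl_trans tree CAs3_step u v -> u = v.
Proof.
move=> /normal_form_reducts nil /clos_rt_rt1n_iff uv.
by case: uv => // w {}v /reductsP; rewrite nil.
Qed.

Lemma normal_form_exists t : exists u,
  clos_refl_trans tree CAs3_step t u /\ normal_form CAs3_rule u.
Proof.
elim/(well_founded_ind CAs3_step_wf): t => t IH.
case E: (reducts CAs3_rules t) => [|v vs].
  by exists t; split; [apply: rt_refl | apply/normal_form_reducts].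
have tv : CAs3_step t v by apply/reductsP; rewrite E mem_head.
have [u [vu nf]] := IH v tv.
by exists u; split=> //; apply: rt_trans vu; apply: rt_step.
Qed.

(** Termination gives a normal form in the class of [t]; two of them have a common
    reduct by confluence, which can only be both of them. *)
Lemma CAs3_unique_avoider t : exists! u, CAs3_cong t u /\ CAs3_avoider u.
Proof.
have [u [tu nfu]] := normal_form_exists t; exists u.
split=> [|v [/CAs3_congE tv /CAs3_avoiderP nfv]].
  by rewrite CAs3_congE CAs3_avoiderP; split=> //; apply: clos_rt_clos_rst.
have uv : clos_refl_sym_trans tree CAs3_step u v.
  by apply: rst_trans tv; apply: rst_sym; apply: clos_rt_clos_rst.
have [w [uw vw]] := church_rosser CAs3_step_confluent uv.
by rewrite (normal_form_steps nfu uw) (normal_form_steps nfv vw).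
Qed.

Theorem proposition3p2 :
  [/\ PBW_basis CAs3_cong CAs3_avoider,
      convergent_orientation CAs3_rule CAs3_cong,
      forall u : tree, CAs3_avoider u <-> normal_form CAs3_rule u &
      forall t : tree, exists! u : tree, CAs3_cong t u /\ CAs3_avoider u].
Proof.
split.
- split; first exact: CAs3_cong_congruence.
  by exists CAs3_rule; split; [apply: CAs3_convergent | apply: CAs3_avoiderP].
- exact: CAs3_convergent.
- exact: CAs3_avoiderP.
- exact: CAs3_unique_avoider.
Qed.
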